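(* Let $R$ be an integral domain, $\kappa\in R$, and $\Phi$ the reduction map defined below. Let $f(y^2)\in R[y]$ and let $m\ge0$ be such that $(y^2-4)^m$ divides $f(y^2)$. For any positive integers $\tilde n\ge n$ with $\mathrm{char}(R)\nmid\tilde n$, \[\Phi(x^{2n}f(y^2))=\frac1{\tilde n}\sum_{i=0}^m\binom{2i}{i}\sum_{\lambda\in\hat\Lambda_{\tilde n}}\left(\frac{\lambda^2-\kappa}{\lambda^2-4}\right)^{i}f(\lambda^2)\,b_{n-i}(x^2)+r(x^2)\] for some $r(x^2)\in R[x]$ of degree at most $\max(\deg f(y^2),\,2n-2m-2)$.
   Context: $F$ is the fraction field of $R$, $\overline F$ its algebraic closure and $\overline R$ the integral closure of $R$ in $\overline F$. $\hat\Lambda_{\tilde n}=\{\zeta+\zeta^{-1}:\zeta\in\overline R,\ \zeta^{2\tilde n}=1\}\setminus\{2\}$ (as a set). For $i\le m$, $\big(\frac{\lambda^2-\kappa}{\lambda^2-4}\big)^if(\lambda^2)$ denotes the value at $y^2=\lambda^2$ of the polynomial $(y^2-\kappa)^if(y^2)/(y^2-4)^i$. $b_k(x)=\sum_{i=0}^k\binom{2i}{i}\frac{x^{k-i}}{1-2i}$ for $k\ge0$ (integer coefficients), and $b_k=0$ for $k<0$ (empty sum). $\Phi:R[x,y,z]\to R[x]$ is the $R$-linear map defined on monomials by recursion on total degree: for $\ell,m',n'\ge1$, $\Phi(x^\ell y^{m'}z^{n'})=\Phi\big(x^{\ell-1}y^{m'-1}z^{n'-1}(x^2+y^2+z^2-\kappa)\big)$;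 for $m',n'\ge1$, $\Phi(y^{m'}z^{n'})=\Phi(2xy^{m'-1}z^{n'-1})$; for $\ell,n'\ge1$, $\Phi(x^\ell z^{n'})=\Phi(2x^{\ell-1}yz^{n'-1})$; for $\ell,m'\ge1$, $\Phi(x^\ell y^{m'})=\Phi(2x^{\ell-1}y^{m'-1}z)$; $\Phi(x^\ell)=x^\ell$, $\Phi(y^{m'})=x^{m'}$, $\Phi(z^{n'})=x^{n'}$.
   Formalization: R is additionally assumed not to have characteristic 2, where the claim fails: for R = F_2, n = ñ = 1, m = 0, f = 1 the set Λ̂_1 is empty, so the right side has degree at most 0, while Φ(x^2) = x^2. *)

(* Defs.v *)
From HB Require Import structures.
From mathcomp Require Import all_boot all_order all_algebra.
From mathcomp Require Import boolp classical_sets cardinality fsbigop.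
From mathcomp Require Import ssrcomplements mpoly.
From mathcomp Require Import zify ring.

Set Implicit Arguments.
Unset Strict Implicit.
Unset Printing Implicit Defensive.

Import GRing.Theory.
Local Open Scope ring_scope.

(* The variables x, y, z of R[x,y,z] = {mpoly R[3]}; univariate polynomials in
   x (or in y) are elements of {poly R}. *)
Definition vx : 'I_3 := @Ordinal 3 0 isT.
Definition vy : 'I_3 := @Ordinal 3 1 isT.
Definition vz : 'I_3 := @Ordinal 3 2 isT.

Section Reduction.
Variables (R : comNzRingType) (kappa : R).

(* Every recursive call lowers the total degree, so that the first argument d
   is fuel: the value does not depend on it as soon as l + m + n <= d. *)
Fixpoint reduce (d l m n : nat) : {poly R} :=
  if d isn't d'.+1 then 1 else
  match l, m, n with
  | l'.+1, m'.+1, n'.+1 =>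
      reduce d' l'.+2 m' n' + reduce d' l' m'.+2 n' + reduce d' l' m' n'.+2
      - kappa *: reduce d' l' m' n'
  | 0, m'.+1, n'.+1 => 2 *: reduce d' 1 m' n'
  | l'.+1, 0, n'.+1 => 2 *: reduce d' l' 1 n'
  | l'.+1, m'.+1, 0 => 2 *: reduce d' l' m' 1
  | _, 0, 0 => 'X^l
  | 0, _, 0 => 'X^m
  | 0, 0, _ => 'X^n
  end.

Definition Phi_mon (l m n : nat) : {poly R} := reduce (l + m + n) l m n.

Definition Phi (p : {mpoly R[3]}) : {poly R} :=
  \sum_(mu <- msupp p) p@_mu *: Phi_mon (mu vx) (mu vy) (mu vz).

Lemma reduce_fuel d e l m n : (l + m + n <= d)%N -> (l + m + n <= e)%N ->
  reduce d l m n = reduce e l m n.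
Proof.
elim: d e l m n => [|d IHd] [|e] l m n.
- by [].
- by rewrite leqn0 !addn_eq0 => /andP[/andP[/eqP-> /eqP->] /eqP->].
- by move=> _; rewrite leqn0 !addn_eq0 => /andP[/andP[/eqP-> /eqP->] /eqP->].
case: l m n => [|l] [|m] [|n] //= hd he.
all: by rewrite !(IHd e) //; lia.
Qed.

Lemma reduceE d l m n : (l + m + n <= d)%N ->
  reduce d l m n = Phi_mon l m n.
Proof. by move=> h; apply: reduce_fuel. Qed.

Lemma Phi_is_linear : linear Phi.
Proof.
have PhiE (p : {mpoly R[3]}) k : (msize p <= k)%N -> Phi p =
    \sum_(mu : 'X_{1..3 < k}) p@_mu *: Phi_mon (mu vx) (mu vy) (mu vz).
  move=> le_pk; rewrite /Phi (big_mksub 'X_{1..3 < k}) ?msupp_uniq //=.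
    by rewrite big_rmcond //= => mu /memN_msupp_eq0 ->; rewrite scale0r.
  by move=> mu /msize_mdeg_lt /leq_trans; apply.
move=> c p q; pose k := maxn (msize (c *: p + q)) (maxn (msize p) (msize q)).
rewrite !(PhiE _ k) ?leq_max ?leqnn ?orbT // scaler_sumr -big_split /=.
by apply: eq_bigr => mu _; rewrite mcoeffD mcoeffZ scalerDl scalerA.
Qed.

HB.instance Definition _ :=
  GRing.isLinear.Build R {mpoly R[3]} {poly R} *:%R Phi Phi_is_linear.

Notation "''x'" := ('X_vx : {mpoly R[3]}).
Notation "''y'" := ('X_vy : {mpoly R[3]}).
Notation "''z'" := ('X_vz : {mpoly R[3]}).

Lemma Phi_monE l m n : Phi ('x ^+ l * 'y ^+ m * 'z ^+ n) = Phi_mon l m n.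
Proof.
rewrite !mpolyXn -!mpolyXD /Phi msuppX big_seq1 mcoeffX eqxx scale1r.
by rewrite !mnmDE !mulmnE !mnm1E /= !mul1n !mul0n !addn0.
Qed.

Lemma Phi_xyz l m n :
  Phi ('x ^+ l.+1 * 'y ^+ m.+1 * 'z ^+ n.+1) =
  Phi ('x ^+ l * 'y ^+ m * 'z ^+ n
       * ('x ^+ 2 + 'y ^+ 2 + 'z ^+ 2 - kappa%:MP)).
Proof.
have -> : 'x ^+ l * 'y ^+ m * 'z ^+ n
       * ('x ^+ 2 + 'y ^+ 2 + 'z ^+ 2 - kappa%:MP) =
     'x ^+ l.+2 * 'y ^+ m * 'z ^+ n + 'x ^+ l * 'y ^+ m.+2 * 'z ^+ n
     + 'x ^+ l * 'y ^+ m * 'z ^+ n.+2 - kappa *: ('x ^+ l * 'y ^+ m * 'z ^+ n).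
  by rewrite -mul_mpolyC !exprS; ring.
rewrite linearB !linearD linearZ /= !Phi_monE {1}/Phi_mon /=.
by rewrite !reduceE //; lia.
Qed.

Lemma Phi_yz m n :
  Phi ('y ^+ m.+1 * 'z ^+ n.+1) = Phi (2 * 'x * 'y ^+ m * 'z ^+ n).
Proof.
rewrite -[X in Phi X]mul1r -(expr0 'x) mulrA Phi_monE.
have -> : 2 * 'x * 'y ^+ m * 'z ^+ n = (2 : R) *: ('x ^+ 1 * 'y ^+ m * 'z ^+ n).
  by rewrite !scaler_nat; ring.
by rewrite linearZ /= Phi_monE {1}/Phi_mon /= reduceE //; lia.
Qed.

Lemma Phi_xz l n :
  Phi ('x ^+ l.+1 * 'z ^+ n.+1) = Phi (2 * 'x ^+ l * 'y * 'z ^+ n).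
Proof.
rewrite -['x ^+ l.+1]mulr1 -(expr0 'y) Phi_monE.
have -> : 2 * 'x ^+ l * 'y * 'z ^+ n = (2 : R) *: ('x ^+ l * 'y ^+ 1 * 'z ^+ n).
  by rewrite !scaler_nat; ring.
by rewrite linearZ /= Phi_monE {1}/Phi_mon /= reduceE //; lia.
Qed.

Lemma Phi_xy l m :
  Phi ('x ^+ l.+1 * 'y ^+ m.+1) = Phi (2 * 'x ^+ l * 'y ^+ m * 'z).
Proof.
rewrite -['x ^+ l.+1 * _]mulr1 -(expr0 'z) Phi_monE.
have -> : 2 * 'x ^+ l * 'y ^+ m * 'z = (2 : R) *: ('x ^+ l * 'y ^+ m * 'z ^+ 1).
  by rewrite !scaler_nat; ring.
by rewrite linearZ /= Phi_monE {1}/Phi_mon /= reduceE //; lia.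
Qed.

Lemma Phi_x l : Phi ('x ^+ l) = 'X^l.
Proof.
have -> : 'x ^+ l = 'x ^+ l * 'y ^+ 0 * 'z ^+ 0 by rewrite !expr0 ?mulr1 ?mul1r.
by rewrite Phi_monE; case: l.
Qed.

Lemma Phi_y m : Phi ('y ^+ m) = 'X^m.
Proof.
have -> : 'y ^+ m = 'x ^+ 0 * 'y ^+ m * 'z ^+ 0 by rewrite !expr0 ?mulr1 ?mul1r.
by rewrite Phi_monE; case: m.
Qed.

Lemma Phi_z n : Phi ('z ^+ n) = 'X^n.
Proof.
have -> : 'z ^+ n = 'x ^+ 0 * 'y ^+ 0 * 'z ^+ n by rewrite !expr0 ?mulr1 ?mul1r.
by rewrite Phi_monE; case: n.
Qed.

End Reduction.

(* f(y^2) as an element of R[x,y,z], where f is a polynomial in t = y^2. *)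
Definition at_y2 (R : comNzRingType) (f : {poly R}) : {mpoly R[3]} :=
  (map_poly (@mpolyC 3 R) f).['X_vy ^+ 2].

(* The integer division is exact, see bcoefK. *)
Definition bcoef (i : nat) : int := ('C(2 * i, i)%:Z %/ (1 - 2 * i%:Z))%Z.

Lemma bcoefK (i : nat) : bcoef i * (1 - 2 * i%:Z) = 'C(2 * i, i)%:Z.
Proof.
apply: divzK; case: i => [|j]; first by rewrite mulr0 subr0 dvd1z.
have -> : 1 - 2 * j.+1%:Z = - (2 * j).+1%:Z by lia.
rewrite dvdzE abszN !absz_nat.
have cop : coprime (2 * j).+1 j.+1.
  rewrite /coprime -dvdn1; have d1 := dvdn_gcdl (2 * j).+1 j.+1.
  have := dvdn_sub (dvdn_mull 2 (dvdn_gcdr (2 * j).+1 j.+1)) d1.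
  by rewrite (_ : 2 * j.+1 - (2 * j).+1 = 1)%N //; lia.
have /= E1 := mul_bin_diag (2 * j).+2 j.
have /= E2 := mul_bin_down (2 * j).+1 j.
have -> : 'C(2 * j.+1, j.+1) = (2 * 'C((2 * j).+1, j))%N.
  have -> : (2 * j.+1 = (2 * j).+2)%N by lia.
  apply/eqP; rewrite -(eqn_pmul2l (ltn0Sn j)) -E1; apply/eqP; lia.
apply: dvdn_mull; rewrite -(Gauss_dvdr _ cop).
have -> : (j.+1 * 'C((2 * j).+1, j) = (2 * j).+1 * 'C(2 * j, j))%N.
  by rewrite E2; congr (_ * _)%N; lia.
exact: dvdn_mulr.
Qed.

Definition bpoly (k : int) : {poly int} :=
  if k is Posz k' then \sum_(i < k'.+1) bcoef i *: 'X^(k' - i) else 0.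

(* The polynomial (y^2 - kappa)^i f(y^2) / (y^2 - 4)^i of R[y].  The divisor is
   monic, so that %/ is the genuine quotient whenever the division is exact. *)
Definition quot_poly (R : idomainType) (kappa : R) (f : {poly R}) (i : nat) :
    {poly R} :=
  (('X^2 - kappa%:P) ^+ i * (f \Po 'X^2)) %/ ('X^2 - 4) ^+ i.

Lemma quot_polyK (R : idomainType) (kappa : R) (f : {poly R}) (m i : nat) :
  (exists g, f \Po 'X^2 = g * ('X^2 - 4) ^+ m) -> (i <= m)%N ->
  quot_poly kappa f i * ('X^2 - 4) ^+ i
  = ('X^2 - kappa%:P) ^+ i * (f \Po 'X^2).
Proof.
move=> [g gE] le_im.
have mon : ('X^2 - 4 : {poly R}) ^+ i \is monic.
  by apply: monic_exp; rewrite -[4]polyC_natr monicXnsubC.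
apply: Pdiv.IdomainUnit.divpK; first by rewrite (monicP mon) unitr1.
by rewrite gE -(subnK le_im) exprD !mulrA dvdp_mulIr.
Qed.

Section AlgebraicClosure.
Variables (R : idomainType) (L : closedFieldType).
Variable (iota : {rmorphism {fraction R} -> L}).

(* L is algebraically closed by its type, so only algebraicity over the
   fraction field remains to be required. *)
Definition is_algebraic_closure : Prop := forall z : L, algebraicOver iota z.

Definition embed : R -> L := iota \o @tofrac R.

HB.instance Definition _ :=
  GRing.RMorphism.copy embed (iota \o @tofrac R).

Definition in_Rbar (z : L) : Prop := integralOver embed z.

Local Open Scope classical_set_scope.

(* A set, not a multiset: in characteristic 2 its elements no longer correspond
   to the angles pi j / N, 0 < j <= N, and Lambda_hat 1 is even empty. *)
Definition Lambda_hat (N : nat) : set L :=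
  [set zeta + zeta^-1 | zeta in
     [set zeta | in_Rbar zeta /\ zeta ^+ (2 * N) = 1]] `\ 2.

(* So \sum_(lambda \in Lambda_hat N) is the honest sum: over a set with infinite
   support it would be 0 by convention. *)
Lemma finite_Lambda_hat (N : nat) : (0 < N)%N -> finite_set (Lambda_hat N).
Proof.
move=> N_gt0; apply: finite_setD; apply: finite_image.
have [s sE] := closed_field_poly_normal ('X^(2 * N) - 1 : {poly L}).
apply: (@sub_finite_set _ _ [set` s]); last exact: finite_seq.
move=> z [_ zN] /=; rewrite -root_prod_XsubC.
have n2 : (0 < 2 * N)%N by rewrite muln_gt0.
move: sE; rewrite -[1]polyC1 (monicP (monicXnsubC _ n2)) scale1r => <-.
by rewrite rootE !hornerE zN subrr.
Qed.

End AlgebraicClosure.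

(* Main.v *)
(** Idea.  Fix x = w + 1/w.  The rotation (y, z) -> (z, x z - y) preserves the
    fibre of the Markoff surface over x, and in the coordinates y = A + B,
    z = w A + B / w it acts by A -> w A, with A B = (x^2 - kappa)/(x^2 - 4).
    Taking the constant term in A is an invariant functional obeying the
    reduction rules of Phi that consume an x.  The other rules only create
    terms of degree at most the y,z-degree, which never grows along the
    reduction, so modulo degree 2d
      Phi(x^(2n) y^(2d)) = C(2d,d) x^(2n) ((x^2 - kappa)/(x^2 - 4))^d.
    Expanding in 1/(x^2 - 4), the coefficient of (4 - kappa)^k/(x^2 - 4)^k in
    Phi(x^(2n) f(y^2)) is x^(2n) times sum_d f_d C(2d,d) C(d,k), which is
    C(2k,k) times the constant term of f(y^2)/(y^2 - 4)^k at y = zeta + 1/zeta;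
    for f of degree less than N this constant term is the average over
    Lambda_hat N.  The same expansion of the right-hand side rests on
      sum_i C(2i,i) C(i,k) X^i sqrt(1 - 4X) = C(2k,k) X^k / (1 - 4X)^k
    at X = x^-2. *)

Require Import Defs.
From HB Require Import structures.
From mathcomp Require Import all_boot all_order all_algebra.
From mathcomp Require Import boolp classical_sets cardinality fsbigop.
From mathcomp Require Import ssrcomplements mpoly.
From mathcomp Require Import cyclic separable cyclotomic zify ring.

Set Implicit Arguments.
Unset Strict Implicit.
Unset Printing Implicit Defensive.

Import GRing.Theory.
Local Open Scope ring_scope.

(** * Degree bounds *)

Section SizeBounds.
Variable R : nzRingType.
Implicit Types p q : {poly R}.

Lemma size_polyD_le k p q :
  (size p <= k)%N -> (size q <= k)%N -> (size (p + q)%R <= k)%N.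
Proof. by move=> pk qk; rewrite (leq_trans (size_polyD _ _)) // geq_max pk. Qed.

Lemma size_polyB_le k p q :
  (size p <= k)%N -> (size q <= k)%N -> (size (p - q)%R <= k)%N.
Proof. by move=> pk qk; rewrite size_polyD_le // size_polyN. Qed.

Lemma size_poly_sum_le k (I : Type) (s : seq I) (P : pred I) (F : I -> {poly R}) :
  (forall i, P i -> (size (F i) <= k)%N) -> (size (\sum_(i <- s | P i) F i)%R <= k)%N.
Proof.
by move=> Fk; apply: (big_ind (fun p : {poly R} => (size p <= k)%N)) => //;
  [rewrite size_poly0 | move=> p q; apply: size_polyD_le].
Qed.

Lemma size_polyM_le a b p q :
  (size p <= a.+1)%N -> (size q <= b)%N -> (size (p * q)%R <= a + b)%N.
Proof.
move=> pa qb; apply: leq_trans (size_polyMleq _ _) _.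
by have := leq_add pa qb; lia.
Qed.

Lemma size_poly_exp_le a p k : (size p <= a.+1)%N -> (size (p ^+ k)%R <= (a * k).+1)%N.
Proof.
move=> pa; elim: k => [|k IHk]; first by rewrite expr0 size_poly1.
by rewrite exprS mulnS -addnS size_polyM_le.
Qed.

Lemma size_poly_nat_le (n : nat) : (size (n%:R : {poly R}) <= 1)%N.
Proof. by rewrite -polyC_natr size_polyC_leq1. Qed.

End SizeBounds.

Lemma size_comp_X2 (R : idomainType) (p : {poly R}) : size (p \Po 'X^2) = (2 * size p).-1.
Proof.
have [->|p0] := eqVneq p 0; first by rewrite comp_poly0 size_poly0.
have sp : (0 < size p)%N by rewrite size_poly_gt0.
have spX : (0 < size (p \Po 'X^2))%N by rewrite size_poly_gt0 comp_poly_eq0 ?size_polyXn.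
have := size_comp_poly p 'X^2; rewrite size_polyXn /=.
by move: sp spX; move: (size p) (size (p \Po _)) => a b; lia.
Qed.

(** * Linear functionals given by their values on monomials *)

Section Moments.
Variables (R : comNzRingType) (V : lmodType R).
Implicit Types (u v : nat -> V) (p q : {poly R}).

Definition moment u p : V := \sum_(k < size p) p`_k *: u k.

Lemma moment_trunc K u p : (size p <= K)%N -> moment u p = \sum_(k < K) p`_k *: u k.
Proof.
move=> pK; rewrite /moment (big_ord_widen _ (fun k => p`_k *: u k) pK).
rewrite big_mkcond; apply: eq_bigr => k _; case: ltnP => // /leq_sizeP -> //.
by rewrite scale0r.
Qed.

Lemma moment_is_linear u : linear (moment u).
Proof.
move=> c p q; pose K := maxn (size (c *: p + q)) (maxn (size p) (size q)).
rewrite !(@moment_trunc K) ?leq_max ?leqnn ?orbT // scaler_sumr -big_split /=.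
by apply: eq_bigr => k _; rewrite coefD coefZ scalerDl scalerA.
Qed.

HB.instance Definition _ u :=
  GRing.isLinear.Build R {poly R} V *:%R (moment u) (moment_is_linear u).

Lemma eq_moment u v p : u =1 v -> moment u p = moment v p.
Proof. by move=> uv; apply: eq_bigr => k _; rewrite uv. Qed.

Lemma moment_mulX u p : moment u ('X * p) = moment (fun k => u k.+1) p.
Proof.
rewrite (@moment_trunc (size p).+1); last by rewrite -add1n size_polyM_le ?size_polyX.
by rewrite big_ord_recl coefXM scale0r add0r; apply: eq_bigr => k _; rewrite coefXM.
Qed.

End Moments.

(** * Rotations of a fibre and the leading part of Phi *)

Definition cbin (k : nat) : nat := 'C(2 * k, k).

Section Chebyshev.
Variable R : comNzRingType.

(* [chebn j] is w^j + w^-j as a polynomial in x = w + 1/w. *)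
Fixpoint chebn (j : nat) : {poly R} :=
  match j with
  | 0 => 2
  | j'.+1 => if j' is j''.+1 then 'X * chebn j' - chebn j'' else 'X
  end.

Definition cheb (j : int) : {poly R} := chebn `|j|%N.

Lemma chebE j : 'X * cheb j = cheb (j + 1) + cheb (j - 1).
Proof.
rewrite /cheb; case: j => [[|j]|j].
- by rewrite /= mulr_natr.
- have -> : absz (j.+1%:Z + 1) = j.+2 by lia.
  have -> : absz (j.+1%:Z - 1) = j by lia.
  by rewrite /= subrK.
- have -> : absz (Negz j + 1) = j by lia.
  have -> : absz (Negz j - 1) = j.+2 by lia.
  by rewrite /= addrC subrK.
Qed.

Lemma size_chebn j : (size (chebn j) <= j.+1)%N /\ (size (chebn j.+1) <= j.+2)%N.
Proof.
elim: j => [|j [IH0 IH1]].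
  by rewrite /= size_polyX; split=> //; apply: size_poly_nat_le.
split; first exact: IH1.
apply: size_polyB_le; last by apply: leq_trans IH0 _; lia.
by rewrite -[j.+3]add1n size_polyM_le ?size_polyX.
Qed.

(* [tau n] sends W^k to w^(2k-n) + w^(n-2k): it is p |-> w^-n p(w^2),
   symmetrised under w -> 1/w. *)
Definition tau (n : nat) : {poly R} -> {poly R} :=
  moment (fun k => cheb (2 * k%:Z - n%:Z)).

HB.instance Definition _ n := GRing.Linear.copy (tau n) (tau n).

(** w^-(n+2) w^2 = w^-n. *)
Lemma tau_shift n p : tau n.+2 ('X * p) = tau n p.
Proof.
by rewrite /tau moment_mulX; apply: eq_moment => k; congr cheb; lia.
Qed.

(** w^-(n+1) (w^2 + 1) = x w^-n. *)
Lemma tau_mulX1 n p : tau n.+1 (('X + 1) * p) = 'X * tau n p.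
Proof.
rewrite /tau mulrDl mul1r linearD /= moment_mulX /moment -big_split mulr_sumr.
apply: eq_bigr => k _ /=; rewrite -scalerAr chebE -scalerDr.
by congr (_ *: (cheb _ + cheb _)); lia.
Qed.

(** w^-(n+2) (w^2 - 1)^2 = w^-n (w - 1/w)^2, and (w - 1/w)^2 = x^2 - 4. *)
Lemma tau_mulX1sq n p : tau n.+2 (('X - 1) ^+ 2 * p) = ('X^2 - 4) * tau n p.
Proof.
have -> : ('X - 1) ^+ 2 * p = ('X + 1) * (('X + 1) * p) + (-4) *: ('X * p).
  by rewrite -mul_polyC rmorphN /= polyC_natr; ring.
rewrite linearD linearZ /= tau_shift !tau_mulX1 -mul_polyC rmorphN /= polyC_natr; ring.
Qed.

Lemma size_tau n (p : {poly R}) : (size p <= n.+1)%N -> (size (tau n p) <= n.+1)%N.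
Proof.
move=> pn; rewrite /tau (moment_trunc _ pn); apply: size_poly_sum_le => k _.
apply: leq_trans (size_scale_leq _ _) _.
by apply: leq_trans (proj1 (size_chebn _)) _; have := ltn_ord k; lia.
Qed.

(** The outer variable stands for A^2 and the inner one for W = w^2: the product is (A + 1/A)^m (w A
    + 1/(w A))^n with denominators cleared. *)
Definition rot_coef (m n s : nat) : {poly R} :=
  ((1 + 'X) ^+ m * (1 + 'X%:P * 'X) ^+ n : {poly {poly R}})`_s.

Lemma coef1DX_exp (c : {poly R}) m s :
  ((1 + c%:P * 'X) ^+ m)`_s = 'C(m, s)%:R * c ^+ s.
Proof.
elim: m s => [|m IHm] [|s].
- by rewrite expr0 coef1 mul1r.
- by rewrite expr0 coef1 mul0r.
- by rewrite exprS mulrDl mul1r coefD -mulrA coefCM coefXM mulr0 addr0 IHm !bin0.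
- by rewrite exprS mulrDl mul1r coefD -mulrA coefCM coefXM /= !IHm binS natrD exprS; ring.
Qed.

Lemma rot_coef_recr m n s :
  rot_coef m n.+1 s.+1 = rot_coef m n s.+1 + 'X * rot_coef m n s.
Proof.
rewrite /rot_coef exprSr mulrA mulrDr mulr1 coefD; congr (_ + _).
by rewrite mulrCA coefCM coefMX.
Qed.

Lemma rot_coefS0 m n : rot_coef m n.+1 0 = rot_coef m n 0.
Proof.
by rewrite /rot_coef exprSr mulrA mulrDr mulr1 coefD mulrCA coefCM coefMX mulr0 addr0.
Qed.

Lemma rot_coef_z0 m s : rot_coef m 0 s = 'C(m, s)%:R.
Proof.
rewrite /rot_coef expr0 mulr1 -['X]mul1r -polyC1 coef1DX_exp expr1n.
by rewrite mulr1.
Qed.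

Lemma rot_coef_y0 n s : rot_coef 0 n s = 'C(n, s)%:R * 'X^s :> {poly R}.
Proof. by rewrite /rot_coef expr0 mul1r coef1DX_exp. Qed.

Lemma rot_coef_y1 n s :
  rot_coef 1 n s.+1 =
  'C(n, s.+1)%:R * 'X^(s.+1) + 'C(n, s)%:R * 'X^s :> {poly R}.
Proof. by rewrite /rot_coef expr1 mulrDl mul1r coefD coefXM !coef1DX_exp. Qed.

Lemma size_rot_coef m n s : (size (rot_coef m n s) <= n.+1)%N.
Proof.
elim: n s => [|n IHn] [|s]; rewrite ?rot_coef_z0 ?size_poly_nat_le //.
  by rewrite rot_coefS0 (leq_trans (IHn _)).
rewrite rot_coef_recr size_polyD_le ?(leq_trans (IHn _)) //.
by rewrite -add1n size_polyM_le ?size_polyX.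
Qed.

(* For m + n = 2s this is twice the constant term in A of
   (A + 1/A)^m (w A + 1/(w A))^n, with W = w^2. *)
Definition rot_ct m n s := tau n (rot_coef m n s).

Lemma size_rot_ct m n s : (size (rot_ct m n s) <= n.+1)%N.
Proof. exact/size_tau/size_rot_coef. Qed.

(** With A B scaled to 1, y = A + 1/A and z = w A + 1/(w A) satisfy x y z = y^2 + z^2 + x^2 - 4; [E]
    is this equation with denominators cleared. *)
Lemma rot_ct_rec m n s :
  'X * rot_ct m.+1 n.+1 s.+1 =
  rot_ct m.+2 n s.+1 + rot_ct m n.+2 s.+1 + ('X^2 - 4) * rot_ct m n s.
Proof.
rewrite /rot_ct -tau_mulX1 -tau_mulX1sq -(tau_shift n (rot_coef m.+2 n s.+1)).
rewrite -!linearD; congr tau; rewrite /rot_coef.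
set A : {poly {poly R}} := 1 + 'X; set B : {poly {poly R}} := 1 + 'X%:P * 'X.
have E : ('X + 1)%:P * (A ^+ m.+1 * B ^+ n.+1) =
    'X%:P * (A ^+ m.+2 * B ^+ n) + A ^+ m * B ^+ n.+2
    + (('X - 1) ^+ 2)%:P * (A ^+ m * B ^+ n * 'X).
  by rewrite /A /B !rmorphXn !rmorphD rmorphN rmorph1 /= !exprS; ring.
by rewrite -coefCM E !coefD !coefCM coefMX.
Qed.

(** The counterpart of the rule x y^(m+1) -> 2 y^m z. Pascal's rule splits the central binomial of
    row m + 1 into two summands, equal because m is odd. *)
Lemma rot_ct_z0 m s : (m.+1 = 2 * s)%N -> 'X * rot_ct m.+1 0 s = 2 * rot_ct m 1 s.
Proof.
case: s => // s ms; rewrite /rot_ct -tau_mulX1 mulr_natl mulr2n -linearD.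
congr tau; rewrite rot_coef_z0 rot_coef_recr !rot_coef_z0 binS natrD.
have le_s : (s <= m)%N by lia.
rewrite -(bin_sub le_s).
have -> : (m - s = s.+1)%N by lia.
by ring.
Qed.

Lemma rot_ct_y0 n s : (n.+1 = 2 * s)%N -> 'X * rot_ct 0 n.+1 s = 2 * rot_ct 1 n s.
Proof.
case: s => // s ns; rewrite /rot_ct -tau_mulX1 mulr_natl mulr2n.
rewrite -(tau_shift n) -linearD.
congr tau; rewrite rot_coef_y0 rot_coef_y1 binS natrD.
have le_s : (s <= n)%N by lia.
rewrite -(bin_sub le_s).
have -> : (n - s = s.+1)%N by lia.
by rewrite !exprS; ring.
Qed.

Lemma rot_ct_yy s : rot_ct (2 * s) 0 s = 2 * (cbin s)%:R.
Proof.
rewrite /rot_ct rot_coef_z0 /tau (@moment_trunc _ _ 1) ?size_poly_nat_le // big_ord1.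
by rewrite -polyC_natr coefC /= -mul_polyC mulrC.
Qed.

End Chebyshev.

(** * Degree of the error in the leading part of Phi *)

Section Asymptotics.
Variables (R : idomainType) (kappa : R).
Hypothesis two_neq0 : (2 : R) != 0.

Lemma size_reduce d l m n : (l + m + n <= d)%N ->
  (size (reduce kappa d l m n) <= (l + m + n).+1)%N.
Proof.
elim: d l m n => [|d IHd] l m n; first by rewrite /= size_poly1.
case: l m n => [|l] [|m] [|n] //= le_d.
all: rewrite ?size_polyXn ?addn0 //.
all: rewrite ?size_polyB_le ?size_polyD_le //; try (apply: leq_trans (size_scale_leq _ _) _).
all: by apply: leq_trans (IHd _ _ _ _) _; lia.
Qed.

Lemma size_X2subC_exp (c : R) s : (size (('X^2 - c%:P) ^+ s)%R <= (2 * s).+1)%N.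
Proof.
by apply/size_poly_exp_le/size_polyB_le; rewrite ?size_polyXn // (leq_trans (size_polyC_leq1 _)).
Qed.

(** The main term obeys every rule that consumes an x, hence so does the error [D]; it can only
    arise once x has run out. The factor 2 matches [rot_ct], which is twice a constant term. *)
Lemma reduce_asymp d l m n s : (l + m + n <= d)%N -> (m + n = 2 * s)%N ->
  (size (2 * (('X^2 - 4) ^+ s * reduce kappa d l m n)
         - 'X^l * ('X^2 - kappa%:P) ^+ s * rot_ct R m n s)%R <= (4 * s).+1)%N.
Proof.
have sz4 k : (size (('X^2 - 4 : {poly R}) ^+ k)%R <= (2 * k).+1)%N.
  by rewrite -[4]polyC_natr size_X2subC_exp.
have ct0 : rot_ct R 0 0 0 = 2 by rewrite (rot_ct_yy R 0) mulr1.
pose D l m n s (r : {poly R}) : {poly R} := 2 * (('X^2 - 4) ^+ s * r)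
  - 'X^l * ('X^2 - kappa%:P) ^+ s * rot_ct R m n s.
rewrite -/(D l m n s (reduce kappa d l m n)).
elim: d l m n s => [|d IHd] l m n s le_d mn_s.
  have [-> -> -> ->] : [/\ l = 0, m = 0, n = 0 & s = 0]%N by split; lia.
  by rewrite /D !expr0 !mul1r /= ct0 mulr1 subrr size_poly0.
case: l le_d => [|l] le_d.
  (* Without x the two terms are bounded separately: degree 2s from the power, at most m + n = 2s
     from the other factor. *)
  rewrite /D expr0 mul1r; apply: size_polyB_le.
    rewrite -[X in (_ <= X)%N]add0n size_polyM_le ?size_poly_nat_le //.
    apply: leq_trans (size_polyM_le (sz4 _) (size_reduce le_d)) _; lia.
  apply: leq_trans (size_polyM_le (size_X2subC_exp _ _) (size_rot_ct _ _ _ _)) _; lia.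
have sz2 (p : {poly R}) : (size p <= (4 * s).+1)%N -> (size ((2 : {poly R}) * p)%R <= (4 * s).+1)%N.
  by move=> sp; rewrite -[X in (_ <= X)%N]add0n size_polyM_le ?size_poly_nat_le.
case: m n le_d mn_s => [|m] [|n] le_d mn_s.
- have -> : s = 0%N by lia.
  by rewrite /D !expr0 !mulr1 !mul1r /= ct0 mulrC subrr size_poly0.
- rewrite [reduce _ _ _ _ _]/= [D _ _ _ _ _](_ : _ = 2 * D l 1 n s (reduce kappa d l 1 n)).
    by apply/sz2/IHd; lia.
  rewrite /D -mul_polyC polyC_natr ['X^(l.+1)]exprS.
  transitivity (2 * (('X^2 - 4) ^+ s * (2 * reduce kappa d l 1 n))
    - 'X^l * ('X^2 - kappa%:P) ^+ s * ('X * rot_ct R 0 n.+1 s)); first ring.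
  by rewrite rot_ct_y0 //; ring.
- rewrite [reduce _ _ _ _ _]/= [D _ _ _ _ _](_ : _ = 2 * D l m 1 s (reduce kappa d l m 1)).
    by apply/sz2/IHd; lia.
  rewrite /D -mul_polyC polyC_natr ['X^(l.+1)]exprS.
  transitivity (2 * (('X^2 - 4) ^+ s * (2 * reduce kappa d l m 1))
    - 'X^l * ('X^2 - kappa%:P) ^+ s * ('X * rot_ct R m.+1 0 s)); first ring.
  by rewrite rot_ct_z0; [ring | lia].
case: s mn_s {sz2} => [|s] mn_s; first lia.
rewrite [reduce _ _ _ _ _]/=.
set r1 := reduce _ _ _ _ _; set r2 := reduce _ _ _ _ _.
set r3 := reduce _ _ _ _ _; set r4 := reduce _ _ _ _ _.
(* Lowering the y,z-degree by 2 costs a factor x^2 - 4, of degree 2, while the bound 4s on the error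
   drops by 4. *)
rewrite [D _ _ _ _ _](_ : _ = D l m.+2 n s.+1 r2 + D l m n.+2 s.+1 r3
    + ('X^2 - 4) * (D l.+2 m n s r1 - kappa%:P * D l m n s r4)); last first.
  rewrite /D -mul_polyC ['X^(l.+1)]exprS.
  transitivity (2 * (('X^2 - 4) ^+ s.+1 * (r1 + r2 + r3 - kappa%:P * r4))
    - 'X^l * ('X^2 - kappa%:P) ^+ s.+1 * ('X * rot_ct R m.+1 n.+1 s.+1)); first ring.
  by rewrite rot_ct_rec !exprS; ring.
apply: size_polyD_le; first by apply: size_polyD_le; apply: IHd; lia.
have sz1 := sz4 1%N; rewrite expr1 in sz1.
rewrite (_ : (4 * s.+1).+1 = 2 + (4 * s + 3))%N ?size_polyM_le //; last by lia.
have szs := fun l' m' n' h h' => leq_trans (IHd l' m' n' s h h').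
apply: size_polyB_le; first by apply: szs; lia.
by rewrite -[X in (_ <= X)%N]add0n size_polyM_le ?size_polyC_leq1 // szs //; lia.
Qed.

(** Every rule flips the parity of all three exponents, and a final monomial has two zero exponents.
    The parity hypotheses stand under the existential so that a witness is at hand for every
    monomial. *)
Lemma Phi_mon_even l m n : exists G : {poly R},
  odd l = odd m -> odd m = odd n -> Phi_mon kappa l m n = G \Po 'X^2.
Proof.
rewrite /Phi_mon; move: (l + m + n)%N => d; elim: d l m n => [|d IHd] l m n.
  by exists 1; rewrite comp_polyC.
have pow k : exists G : {poly R}, ~~ odd k -> 'X^k = G \Po 'X^2.
  exists ('X^(k./2)); rewrite comp_Xn_poly -exprM => ev.
  by rewrite mul2n even_halfK.
case: l m n => [|l] [|m] [|n].
- by have [G h] := pow 0%N; exists G => _ _; apply: h.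
- by have [G h] := pow n.+1; exists G => _ /= e; apply: h; rewrite /= -e.
- by have [G h] := pow m.+1; exists G => /= e _; apply: h; rewrite /= -e.
- have [G h] := IHd 1%N m n; exists (2 *: G) => e1 e2 /=.
  by rewrite comp_polyZ h //; move: e1 e2 => /=; do 2 case: odd.
- by have [G h] := pow l.+1; exists G => /= e _; apply: h; rewrite /= e.
- have [G h] := IHd l 1%N n; exists (2 *: G) => e1 e2 /=.
  by rewrite comp_polyZ h //; move: e1 e2 => /=; do 2 case: odd.
- have [G h] := IHd l m 1%N; exists (2 *: G) => e1 e2 /=.
  by rewrite comp_polyZ h //; move: e1 e2 => /=; do 2 case: odd.
have [G1 h1] := IHd l.+2 m n; have [G2 h2] := IHd l m.+2 n.
have [G3 h3] := IHd l m n.+2; have [G4 h4] := IHd l m n.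
exists (G1 + G2 + G3 - kappa *: G4) => /= /negb_inj e1 /negb_inj e2.
by rewrite comp_polyB !comp_polyD comp_polyZ h1 ?h2 ?h3 ?h4 //= ?negbK ?e1 ?e2.
Qed.

Lemma Phi_mon_asymp n d : exists G : {poly R},
  Phi_mon kappa (2 * n) (2 * d) 0 = G \Po 'X^2 /\
  (size (('X - 4) ^+ d * G
    - (cbin d)%:R * 'X^n * ('X - kappa%:P) ^+ d)%R <= (2 * d).+1)%N.
Proof.
have [G GE] := Phi_mon_even (2 * n) (2 * d) 0.
exists G; split; first by apply: GE; rewrite !oddM.
set p := _ - _; suff : (size (p \Po 'X^2) <= (4 * d).+1)%N.
  by rewrite size_comp_X2; move: (size p) => k; lia.
have h := @reduce_asymp (2 * n + 2 * d + 0) (2 * n) (2 * d) 0 d (leqnn _) (addn0 _).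
rewrite -/(Phi_mon _ _ _ _) GE ?oddM // in h.
(* The factor 2 of [reduce_asymp] does not affect the size, since 2 is nonzero. *)
have -> : size (p \Po 'X^2) = size (2 *: (p \Po 'X^2)).
  by rewrite size_scale.
apply: leq_trans h; rewrite leq_eqVlt; apply/orP; left; apply/eqP; congr (size (polyseq _)).
rewrite /p -mul_polyC polyC_natr comp_polyB !comp_polyM !rmorphXn /= !comp_polyB.
rewrite comp_polyX -[4]polyC_natr -[(cbin _)%:R]polyC_natr !comp_polyC rot_ct_yy.
by rewrite !polyC_natr exprM; ring.
Qed.

End Asymptotics.

(** * Central binomial convolutions *)

Lemma cbinS k : (k.+1 * cbin k.+1 = (4 * k + 2) * cbin k)%N.
Proof.
rewrite /cbin.
have /= E1 := mul_bin_diag (2 * k).+2 k.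
have /= E2 := mul_bin_down (2 * k).+1 k.
have E3 : ((2 * k).+1 - k = k.+1)%N by lia.
rewrite E3 in E2; have -> : (2 * k.+1 = (2 * k).+2)%N by lia.
nia.
Qed.

(* The coefficient of X^d in X^k (1 - 4X)^(-k - 1/2). *)
Fixpoint shifted_cbin (k d : nat) : nat :=
  match k, d with
  | 0, _ => cbin d
  | k'.+1, 0 => 0
  | k'.+1, d'.+1 => 4 * shifted_cbin k d' + shifted_cbin k' d'
  end.

Lemma shifted_cbin0 d : shifted_cbin 0 d = cbin d.
Proof. by case: d. Qed.

Lemma shifted_cbinSS k d : (shifted_cbin k.+1 d.+1 =
  4 * shifted_cbin k.+1 d + shifted_cbin k d)%N.
Proof. by []. Qed.

(** Both sides are the coefficient of X^d in X^k / k! times the k-th derivative of (1 -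
    4X)^(-1/2). *)
Lemma shifted_cbinE k d : (cbin k * shifted_cbin k d = cbin d * 'C(d, k))%N.
Proof.
elim: k d => [|k IHk] d; first by rewrite bin0 muln1 mul1n shifted_cbin0.
elim: d => [|d IHd]; first by rewrite bin0n !muln0.
apply/eqP; rewrite -(eqn_pmul2l (ltn0Sn k)); apply/eqP.
have Ck := cbinS k; have Cd := cbinS d; have Ik := IHk d.
have B1 := mul_bin_diag d.+1 k; have B2 := mul_bin_left d k.
rewrite /= in B1.
have le : ('C(d, k) = 0)%N \/ (k <= d)%N.
  have [h|h] := leqP k d; first by right.
  by left; apply: bin_small.
transitivity (4 * k.+1 * (cbin d * 'C(d, k.+1)) + (4 * k + 2) * (cbin d * 'C(d, k)))%N.
  by rewrite shifted_cbinSS -IHd -Ik; nia.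
transitivity ((4 * d + 2) * cbin d * 'C(d, k))%N; last by rewrite -Cd [RHS]mulnCA -B1; lia.
have -> : (4 * k.+1 * (cbin d * 'C(d, k.+1)) = 4 * cbin d * (k.+1 * 'C(d, k.+1)))%N by lia.
rewrite B2; case: le => [->|le]; first lia.
have -> : (4 * d + 2 = 4 * (d - k) + (4 * k + 2))%N by lia.
ring.
Qed.

(** The square of (1 - 4X)^(-1/2) is 1 / (1 - 4X). *)
Lemma cbin_conv s : (\sum_(i < s.+1) cbin i * cbin (s - i) = 4 ^ s)%N.
Proof.
pose S s := (\sum_(i < s.+1) cbin i * cbin (s - i))%N; rewrite -/(S s).
(* [T] is summed in two ways: by the symmetry i <-> s - i, and by [cbinS]. *)
pose T s := (\sum_(i < s.+1) i * (cbin i * cbin (s - i)))%N.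
have TE r : (2 * T r = r * S r)%N.
  rewrite mul2n -addnn {2}/T (reindex_inj rev_ord_inj) /T -big_split /S big_distrr /=.
  apply: eq_bigr => i _; have le_ir := leq_ord i.
  by rewrite subSS subKn // -[X in _ = (X * _)%N](subnK le_ir); ring.
have TS r : (T r.+1 = 4 * T r + 2 * S r)%N.
  rewrite /T big_ord_recl mul0n add0n /S !big_distrr -big_split /=.
  apply: eq_bigr => i _; rewrite /bump /= add1n subSS mulnA cbinS; ring.
elim: s => [|s IHs]; first by rewrite /S big_ord1.
rewrite expnS -IHs; apply/eqP; rewrite -(eqn_pmul2l (ltn0Sn s)) -TE TS.
by apply/eqP; rewrite mulnDr mulnCA TE; lia.
Qed.

Lemma bcoef0 : bcoef 0 = 1.
Proof. by []. Qed.

(** [bcoef] generates sqrt(1 - 4X), which is (1 - 4X) (1 - 4X)^(-1/2). *)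
Lemma bcoefS k : bcoef k.+1 = (cbin k.+1)%:Z - 4 * (cbin k)%:Z.
Proof.
have n0 : 1 - 2 * k.+1%:Z != 0 by apply/eqP; lia.
apply: (mulIf n0); rewrite bcoefK -/(cbin _).
have := cbinS k; set a := cbin _; set b := cbin _ => h.
have {}h : k.+1%:Z * a%:Z = (4 * k%:Z + 2) * b%:Z by lia.
have -> : (a%:Z - 4 * b%:Z) * (1 - 2 * k.+1%:Z) =
  a%:Z - 2 * (k.+1%:Z * a%:Z) + (8 * k.+1%:Z - 4) * b%:Z by ring.
rewrite h; lia.
Qed.

Lemma cbin_bcoef_conv s :
  \sum_(i < s.+1) (cbin i)%:Z * bcoef (s - i) = (s == 0)%:Z.
Proof.
case: s => [|s]; first by rewrite big_ord1.
rewrite big_ord_recr /= subnn bcoef0 mulr1.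
rewrite (eq_bigr (fun i : 'I_s.+1 =>
  (cbin i * cbin (s.+1 - i))%:Z - 4 * (cbin i * cbin (s - i))%:Z)).
  rewrite sumrB -mulr_sumr -!(big_morph Posz PoszD (erefl _)) cbin_conv.
  have := cbin_conv s.+1; rewrite big_ord_recr /= subnn muln1 expnS; lia.
move=> i _; by rewrite (subSn (leq_ord i)) bcoefS !PoszM; ring.
Qed.

(** * Truncations of sqrt(1 - 4/x) *)

Section SqrtTruncation.
Variable R : comNzRingType.

(** The polynomial part of X^k sqrt(1 - 4/X). *)
Definition btrunc (k : nat) : {poly R} := map_poly intr (bpoly k).

Lemma btruncS k : btrunc k.+1 = 'X * btrunc k + (bcoef k.+1)%:~R%:P.
Proof.
rewrite /btrunc /= big_ord_recr /= subnn expr0 rmorphD /= alg_polyC map_polyC /=.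
congr (_ + _); rewrite -['X in RHS](map_polyX intr) -rmorphM mulr_sumr /=.
congr (map_poly _ _); apply: eq_bigr => i _.
by rewrite -scalerAr -exprS (subSn (leq_ord i)).
Qed.

Lemma size_btrunc k : (size (btrunc k) <= k.+1)%N.
Proof.
elim: k => [|k IHk].
  rewrite /btrunc /= big_ord1 subnn expr0 alg_polyC map_polyC; exact: size_polyC_leq1.
rewrite btruncS; apply: size_polyD_le; last exact: leq_trans (size_polyC_leq1 _) _.
by rewrite -add1n size_polyM_le ?size_polyX.
Qed.

(** Truncates the product of X^n sqrt(1 - 4/X) and X^-k (1 - 4/X)^(-k - 1/2), which is X^n / (X -
    4)^k. *)
Definition btrunc_sum k m n : {poly R} :=
  \sum_(i < m.+1) (shifted_cbin k i)%:R *: btrunc (n - i).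

Lemma btrunc_sum_diag n : btrunc_sum 0 n n = 'X^n.
Proof.
elim: n => [|n IHn].
  by rewrite /btrunc_sum big_ord1 /btrunc /= big_ord1 expr0 alg_polyC map_polyC scale1r.
have -> : btrunc_sum 0 n.+1 n.+1 = 'X * btrunc_sum 0 n n
    + (\sum_(i < n.+2) (cbin i)%:Z * bcoef (n.+1 - i))%:~R%:P.
  rewrite /btrunc_sum big_ord_recr [in X in _ = _ + X]big_ord_recr /= subnn.
  rewrite [X in X + _](eq_bigr (fun i : 'I_n.+1 =>
    'X * ((shifted_cbin 0 i)%:R *: btrunc (n - i))
    + ((cbin i)%:Z * bcoef (n.+1 - i))%:~R%:P)).
    rewrite big_split /= -mulr_sumr -addrA; congr (_ + _).
    rewrite intrD (rmorph_sum intr) polyCD (rmorph_sum (polyC (R:=R))) /=; congr (_ + _).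
    rewrite /btrunc /= big_ord1 expr0 alg_polyC map_polyC /= -mul_polyC.
    by rewrite -polyCM intrM.
  move=> i _; rewrite (subSn (leq_ord i)) btruncS scalerDr shifted_cbin0 -scalerAr.
  by congr (_ + _); rewrite -mul_polyC -polyCM intrM.
by rewrite cbin_bcoef_conv IHn addr0 -exprS.
Qed.

(** Raising n by 1 multiplies by X up to a constant, so the error gains at most one degree per step
    from the exact case n = m. *)
Lemma btrunc_sum0_approx m n : (m <= n)%N ->
  (size ('X^n - btrunc_sum 0 m n)%R <= n - m)%N.
Proof.
move=> le_mn; rewrite -(subnK le_mn); set r := (n - m)%N.
rewrite addnK; elim: r => [|r IHr].
  by rewrite add0n btrunc_sum_diag subrr size_poly0.
have -> : 'X^(r.+1 + m) - btrunc_sum 0 m (r.+1 + m) = 'X * ('X^(r + m) - btrunc_sum 0 m (r + m))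
  - (\sum_(i < m.+1) (cbin i)%:R * (bcoef (r.+1 + m - i))%:~R)%:P.
  rewrite mulrBr -exprS -addrA -opprD; congr (_ - _).
  rewrite /btrunc_sum mulr_sumr rmorph_sum -big_split /=; apply: eq_bigr => i _.
  have -> : (r.+1 + m - i = (r + m - i).+1)%N by have := ltn_ord i; lia.
  rewrite btruncS scalerDr shifted_cbin0 -scalerAr.
  by congr (_ + _); rewrite -mul_polyC -polyCM.
apply: size_polyB_le; last by apply: leq_trans (size_polyC_leq1 _) _.
by rewrite -add1n size_polyM_le ?size_polyX.
Qed.

(** Summation by parts with the recursion of [shifted_cbin]: the term in [btrunc (n - m)] is the
    boundary term, and c collects the constants of [btruncS]. *)
Lemma btrunc_sumS k m n : (m <= n)%N -> exists c : R,
  ('X - 4) * btrunc_sum k.+1 m n = btrunc_sum k m n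
    - (shifted_cbin k.+1 m.+1)%:R *: btrunc (n - m) - c%:P.
Proof.
elim: m => [_|m IHm lt_mn].
  exists 0; rewrite /btrunc_sum !big_ord1 scale0r mulr0 subn0 shifted_cbinSS muln0.
  by rewrite subrr subr0.
have [c cE] := IHm (ltnW lt_mn).
have snoc j : btrunc_sum j m.+1 n =
  btrunc_sum j m n + (shifted_cbin j m.+1)%:R *: btrunc (n - m.+1).
  by rewrite /btrunc_sum big_ord_recr.
exists (c + (shifted_cbin k.+1 m.+1)%:R * (bcoef (n - m))%:~R).
rewrite !snoc mulrDr cE.
have -> : (n - m = (n - m.+1).+1)%N by lia.
rewrite btruncS (shifted_cbinSS k m.+1) natrD natrM -!mul_polyC.
by rewrite !polyCD !polyCM !polyC_natr; ring.
Qed.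

Lemma size_X4_exp k : (size (('X - 4 : {poly R}) ^+ k)%R <= k.+1)%N.
Proof.
rewrite -[k in (_ <= k.+1)%N]mul1n size_poly_exp_le // -[4]polyC_natr.
by apply: size_polyB_le; rewrite ?size_polyX // (leq_trans (size_polyC_leq1 _)).
Qed.

Lemma btrunc_sum_approx k m n : (m <= n)%N ->
  (size ('X^n - ('X - 4) ^+ k * btrunc_sum k m n)%R <= n + k - m)%N.
Proof.
move=> le_mn; elim: k => [|k IHk]; first by rewrite mul1r addn0 btrunc_sum0_approx.
have [c cE] := btrunc_sumS k le_mn; rewrite exprSr -mulrA cE.
set b := _ *: _; have -> : 'X^n - ('X - 4) ^+ k * (btrunc_sum k m n - b - c%:P) =
  'X^n - ('X - 4) ^+ k * btrunc_sum k m n + ('X - 4) ^+ k * (b + c%:P) by ring.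
apply: size_polyD_le; first by apply: leq_trans IHk _; lia.
have sb : (size (b + c%:P)%R <= (n - m).+1)%N.
  apply: size_polyD_le; last by apply: leq_trans (size_polyC_leq1 _) _.
  exact: leq_trans (size_scale_leq _ _) (size_btrunc _).
apply: leq_trans (size_polyM_le (size_X4_exp k) sb) _; lia.
Qed.

(* [ct p] is the constant term of p((zeta + 1/zeta)^2). *)
Definition ct : {poly R} -> R^o := moment (fun d => (cbin d)%:R : R^o).

(** Multiplication by X - 4 undoes the recursion of [shifted_cbin]. This is how division of f(y^2)
    by (y^2 - 4)^k is read off from the coefficients of f. *)
Lemma shifted_ct k p :
  moment (fun d => (shifted_cbin k d)%:R : R^o) (('X - 4) ^+ k * p) = ct p.
Proof.
elim: k p => [|k IHk] p.
  by rewrite mul1r; apply: eq_moment => d; rewrite shifted_cbin0.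
rewrite exprS -mulrA -IHk; move: (_ * p) => q.
rewrite -[4]polyC_natr mulrBl mul_polyC linearB linearZ /= moment_mulX.
rewrite /moment scaler_sumr -sumrB; apply: eq_bigr => d _.
rewrite shifted_cbinSS natrD natrM scalerDr [X in X - _]addrC.
by rewrite -![_ *: _ : R^o]/(_ * _) mulrCA addrK.
Qed.

End SqrtTruncation.

(** * The truncated expansion *)

Section Core.
Variables (R : idomainType) (kappa : R).

(** Expands X - kappa around 4; D is a common exponent clearing the denominators (X - 4)^k. *)
Lemma subX_shift_exp d D : (d <= D)%N ->
  ('X - kappa%:P) ^+ d * ('X - 4) ^+ (D - d) =
  \sum_(k < D.+1) ('C(d, k)%:R * (4 - kappa) ^+ k) *: ('X - 4) ^+ (D - k) :> {poly R}.
Proof.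
move=> le_dD; have -> : 'X - kappa%:P = ('X - 4) + (4 - kappa)%:P :> {poly R}.
  by rewrite polyCB polyC_natr; ring.
rewrite exprDn (big_ord_widen D.+1 (fun k => (('X - 4) ^+ (d - k)
   * (4 - kappa)%:P ^+ k) *+ 'C(d, k))) //.
rewrite big_mkcond mulr_suml; apply: eq_bigr => k _.
case: ltnP => [le_kd|lt_dk]; last by rewrite bin_small // mulr0n !mul0r scale0r.
have -> : (D - k = (d - k) + (D - d))%N by move: le_kd; lia.
rewrite exprD -mul_polyC polyCM polyC_exp polyC_natr -mulr_natl; ring.
Qed.

(** Both sums are compared with X^n times the sum of [a k] / (X - 4)^k, after multiplication by (X -
    4)^D with D the degree of f; this monic factor is divided out at the end. For k <= m, [F k] is
    the constant term of f(y^2) / (y^2 - 4)^k. *)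
Lemma approx_core n m (f g : {poly R}) (G : nat -> {poly R}) :
  f = ('X - 4) ^+ m * g -> f != 0 -> (size f <= n)%N ->
  (forall d, (size (('X - 4) ^+ d * G d
     - (cbin d)%:R * 'X^n * ('X - kappa%:P) ^+ d)%R <= (2 * d).+1)%N) ->
  (size (\sum_(d < size f) f`_d *: G d
     - \sum_(i < m.+1) (cbin i)%:R *:
         (ct (('X - kappa%:P) ^+ i * ('X - 4) ^+ (m - i) * g) *: btrunc R (n - i)))%R
    <= maxn (size f) (n - m))%N.
Proof.
move=> fE f0 le_fn asymp.
have P_monic : ('X - 4 : {poly R}) \is monic by rewrite -[4]polyC_natr monicXsubC.
have sP : size ('X - 4 : {poly R}) = 2 by rewrite -[4]polyC_natr size_XsubC.
have sPn k : size (('X - 4 : {poly R}) ^+ k) = k.+1.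
  by rewrite -[4]polyC_natr size_exp_XsubC.
have g0 : g != 0 by apply: contraNneq f0 => g0; rewrite fE g0 mulr0.
have szf : size f = (m + size g)%N.
  by rewrite fE size_monicM ?monic_exp // sPn addSn.
have sg : (0 < size g)%N by rewrite size_poly_gt0.
pose D := (size f).-1; have Df : size f = D.+1 by rewrite /D; lia.
have le_mD : (m <= D)%N by lia.
pose F k := moment (fun d => (shifted_cbin k d)%:R : R^o) f.
pose a k : R := (cbin k)%:R * (4 - kappa) ^+ k * F k.
have FE k : (k <= m)%N -> F k = ct (('X - 4) ^+ (m - k) * g).
  by move=> le_km; rewrite /F fE -{1}(subnKC le_km) exprD -mulrA shifted_ct.
set S1 := \sum_(d < size f) _; set S2 := \sum_(i < m.+1) _.
(* After expansion around 4, [shifted_cbinE] turns C(2i,i) C(i,k) into C(2k,k) times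
   [shifted_cbin k i]. *)
have S2E : S2 = \sum_(k < m.+1) a k *: btrunc_sum R k m n.
  rewrite /S2 /btrunc_sum.
  under [RHS]eq_bigr => k _ do rewrite scaler_sumr.
  rewrite exchange_big /=; apply: eq_bigr => i _.
  rewrite (subX_shift_exp (leq_ord i)) mulr_suml /ct linear_sum /= scaler_suml scaler_sumr.
  apply: eq_bigr => k _; rewrite -scalerAl [moment _ _]linearZ /= -/(ct _) -(FE _ (leq_ord k)).
  rewrite !scalerA; congr (_ *: _).
  rewrite -[_ *: _ : R^o]/(_ * _) /a.
  have := congr1 (fun j => j%:R : R) (shifted_cbinE k i); rewrite !natrM => h.
  by rewrite mulrA [X in X * F k]mulrA -h; ring.
have S1E : (size (('X - 4) ^+ D * S1
    - 'X^n * \sum_(k < D.+1) a k *: ('X - 4) ^+ (D - k))%R <= (2 * D).+1)%N.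
  have -> : \sum_(k < D.+1) a k *: ('X - 4) ^+ (D - k) =
     \sum_(d < D.+1) (f`_d * (cbin d)%:R) *: (('X - kappa%:P) ^+ d * ('X - 4) ^+ (D - d)).
    transitivity (\sum_(d < D.+1) \sum_(k < D.+1) (f`_d * (cbin d)%:R) *:
       (('C(d, k)%:R * (4 - kappa) ^+ k) *: ('X - 4 : {poly R}) ^+ (D - k))); last first.
      by apply: eq_bigr => d _; rewrite (subX_shift_exp (leq_ord d)) scaler_sumr.
    rewrite exchange_big /=; apply: eq_bigr => k _.
    rewrite /a /F /moment Df mulr_sumr scaler_suml; apply: eq_bigr => d _.
    rewrite scalerA; congr (_ *: _); rewrite -[_ *: _ : R^o]/(_ * _).
    have := congr1 (fun j => j%:R : R) (shifted_cbinE k d); rewrite !natrM => h.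
    transitivity (f`_d * (4 - kappa) ^+ k * ((cbin k)%:R * (shifted_cbin k d)%:R)); first ring.
    rewrite h; ring.
  rewrite /S1 Df !mulr_sumr -sumrB; apply: size_poly_sum_le => d _.
  have le_dD : (d <= D)%N := leq_ord d.
  rewrite -{1}(subnK le_dD) exprD -mul_polyC -[_ *: (_ * _)]mul_polyC polyCM polyC_natr.
  have -> : ('X - 4) ^+ (D - d) * ('X - 4) ^+ d * ((f`_d)%:P * G d) -
    'X^n * ((f`_d)%:P * (cbin d)%:R * (('X - kappa%:P) ^+ d * ('X - 4) ^+ (D - d))) =
    (f`_d)%:P * (('X - 4) ^+ (D - d) * (('X - 4) ^+ d * G d - (cbin d)%:R * 'X^n * ('X - kappa%:P) ^+ d)).
    by ring.
  rewrite -[X in (_ <= X)%N]add0n size_polyM_le ?size_polyC_leq1 //.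
  apply: leq_trans (size_polyM_le (size_X4_exp _ _) (asymp d)) _; lia.
have S2D : (size ('X^n * (\sum_(k < D.+1) a k *: ('X - 4) ^+ (D - k))
    - ('X - 4) ^+ D * S2)%R <= D + (n - m))%N.
  rewrite S2E (big_ord_widen D.+1 (fun k => a k *: btrunc_sum R k m n)) //.
  rewrite (big_mkcond (fun i : 'I_D.+1 => _ < _)%N) !mulr_sumr -sumrB.
  apply: size_poly_sum_le => k _; have le_kD : (k <= D)%N := leq_ord k.
  case: ltnP => [lt_km|lt_mk].
    have -> : ('X - 4) ^+ D = ('X - 4) ^+ (D - k) * ('X - 4) ^+ k :> {poly R}.
      by rewrite -exprD subnK.
    rewrite -!scalerAr -scalerBr.
    apply: leq_trans (size_scale_leq _ _) _.
    rewrite mulrC -mulrA -mulrBr.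
    have h := @btrunc_sum_approx R k m n ltac:(lia).
    apply: leq_trans (size_polyM_le (size_X4_exp _ _) h) _; lia.
  (* Terms with k > m are absent from [S2], but X^n (X - 4)^(D - k) is already of low enough
     degree. *)
  rewrite mulr0 subr0 -scalerAr; apply: leq_trans (size_scale_leq _ _) _.
  rewrite mulrC.
  have hX : (size ('X^n : {poly R}) <= n.+1)%N by rewrite size_polyXn.
  apply: leq_trans (size_polyM_le (size_X4_exp _ _) hX) _; lia.
have : (size (('X - 4) ^+ D * (S1 - S2))%R <= D + maxn (size f) (n - m))%N.
  have -> : ('X - 4) ^+ D * (S1 - S2) =
   (('X - 4) ^+ D * S1 - 'X^n * \sum_(k < D.+1) a k *: ('X - 4) ^+ (D - k))
   + ('X^n * (\sum_(k < D.+1) a k *: ('X - 4) ^+ (D - k)) - ('X - 4) ^+ D * S2).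
    by rewrite mulrBr addrA subrK.
  apply: size_polyD_le; first by apply: leq_trans S1E _; rewrite Df; lia.
  by apply: leq_trans S2D _; lia.
have [->|nz] := eqVneq (S1 - S2) 0; first by rewrite size_poly0.
by rewrite size_monicM ?monic_exp // sPn addSn /= leq_add2l.
Qed.

(** A crude bound, enough when deg f >= n, since the remainder may then be as large as f. *)
Lemma approx_size n d (G : {poly R}) :
  (size (('X - 4) ^+ d * G - (cbin d)%:R * 'X^n * ('X - kappa%:P) ^+ d)%R
    <= (2 * d).+1)%N -> (size G <= (maxn d n).+1)%N.
Proof.
have [->|nz] := eqVneq G 0; first by rewrite size_poly0.
have P_monic : ('X - 4 : {poly R}) \is monic by rewrite -[4]polyC_natr monicXsubC.
set p := _ * 'X^n * _ => h.
have sp : (size p <= (n + d).+1)%N.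
  rewrite /p -mulrA -[X in (_ <= X)%N]add0n size_polyM_le ?size_poly_nat_le //.
  rewrite -addnS size_polyM_le ?size_polyXn //.
  by rewrite size_exp_XsubC.
have : (size (('X - 4) ^+ d * G)%R <= (d + maxn d n).+1)%N.
  rewrite -(subrK p (_ * G)); apply: size_polyD_le.
    by apply: leq_trans h _; lia.
  by apply: leq_trans sp _; lia.
rewrite size_monicM ?monic_exp // -[4]polyC_natr size_exp_XsubC addSn /=.
by rewrite -addnS leq_add2l.
Qed.

End Core.

(** * Passing to polynomials in t = y^2 *)

Lemma Phi_at_y2 (R : comNzRingType) (kappa : R) n (f : {poly R}) :
  Phi kappa ('X_vx ^+ n * at_y2 f) =
  \sum_(d < size f) f`_d *: Phi_mon kappa n (2 * d) 0.
Proof.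
rewrite /at_y2 /map_poly horner_poly mulr_sumr linear_sum; apply: eq_bigr => d _ /=.
rewrite -exprM mulrCA mul_mpolyC linearZ /=; congr (_ *: _).
by rewrite -[X in Phi _ X]mulr1 -(expr0 'X_vz) Phi_monE.
Qed.

Section Factoring.
Variable R : idomainType.
Implicit Types p g : {poly R}.

Lemma XsubC_comp_X2 (c : R) k : ('X - c%:P) ^+ k \Po 'X^2 = ('X^2 - c%:P) ^+ k.
Proof. by rewrite rmorphXn /= comp_polyB comp_polyX comp_polyC. Qed.

(** The remainder of p by (t - c)^m has degree below m; at t = X^2 it becomes a multiple of (X^2 -
    c)^m of degree below 2m, hence zero. *)
Lemma dvd_comp_X2 p g m (c : R) : p \Po 'X^2 = g * ('X^2 - c%:P) ^+ m ->
  exists h, p = ('X - c%:P) ^+ m * h.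
Proof.
move=> pE; have mon : ('X - c%:P) ^+ m \is monic by rewrite monic_exp ?monicXsubC.
have dE := Pdiv.IdomainMonic.divp_eq mon p.
set q := p %/ _ in dE; set r := p %% _ in dE.
exists q; rewrite dE mulrC.
suff -> : r = 0 by rewrite addr0.
have sr : (size r <= m)%N.
  by rewrite -ltnS -(size_exp_XsubC m c) ltn_modp monic_neq0.
have rE : r \Po 'X^2 = (g - (q \Po 'X^2)) * ('X^2 - c%:P) ^+ m.
  by rewrite mulrBl -pE {1}dE comp_polyD comp_polyM XsubC_comp_X2 addrC addKr.
have mon2 : ('X^2 - c%:P) ^+ m \is monic by rewrite monic_exp // monicXnsubC.
have [h0|nz] := eqVneq (g - (q \Po 'X^2)) 0.
  by apply/eqP; rewrite -(@comp_poly_eq0 _ r 'X^2) ?size_polyXn // rE h0 mul0r.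
have := size_Mmonic nz mon2; rewrite -rE size_comp_X2 -XsubC_comp_X2.
rewrite size_comp_X2 size_exp_XsubC; move: nz; rewrite -size_poly_gt0.
by move: sr; move: (size r) (size (g - _)) => a b; lia.
Qed.

Lemma quot_poly_comp_X2 kappa f g m i : f = ('X - 4) ^+ m * g -> (i <= m)%N ->
  quot_poly kappa f i = (('X - kappa%:P) ^+ i * ('X - 4) ^+ (m - i) * g) \Po 'X^2.
Proof.
move=> fE le_im; rewrite /quot_poly.
have mon : ('X^2 - 4 : {poly R}) ^+ i \is monic.
  by rewrite monic_exp // -[4]polyC_natr monicXnsubC.
rewrite -[RHS](Pdiv.IdomainMonic.mulpK mon); congr (_ %/ _).
rewrite fE -{1}(subnK le_im) exprD !comp_polyM -[4]polyC_natr !XsubC_comp_X2.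
ring.
Qed.

End Factoring.

(** * Averages over roots of unity *)

Section RootsOfUnity.
Variables (L : closedFieldType).

Lemma closed_prim_root n : n%:R != 0 :> L -> {z : L | n.-primitive_root z}.
Proof.
move=> n0; have n_gt0 : (0 < n)%N by case: n n0 => //; rewrite eqxx.
have [rs rsE] := closed_field_poly_normal ('X^n - 1 : {poly L}).
have lc : lead_coef ('X^n - 1 : {poly L}) = 1.
  by apply/eqP; rewrite -polyC1; apply: monicXnsubC.
rewrite lc scale1r in rsE.
have urs : uniq rs by rewrite -separable_prod_XsubC -rsE separable_Xn_sub_1.
have : has n.-primitive_root rs.
  apply: has_prim_root => //.
    by apply/allP => z zrs; rewrite /root_of_unity rsE root_prod_XsubC.
  by rewrite -ltnS -(size_prod_XsubC rs id) -rsE -polyC1 size_XnsubC.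
by move/hasP/sig2W => [z _ zP]; exists z.
Qed.

Lemma sum_exp_root1 N (w : L) : w ^+ N = 1 ->
  \sum_(1 <= j < N.+1) w ^+ j = (if w == 1 then N else 0)%:R.
Proof.
move=> wN; rewrite big_add1 /= big_mkord; case: eqVneq => [->|w1].
  by under eq_bigr do rewrite expr1n; rewrite sumr_const card_ord.
under eq_bigr do rewrite exprS.
rewrite -mulr_sumr; apply/eqP; rewrite mulf_eq0; apply/orP; right.
have w10 : w - 1 != 0 by rewrite subr_eq0.
by rewrite -(mulIr_eq0 _ (mulIf w10)) mulrC -subrX1 wN subrr.
Qed.

(* The constant term of (zeta + 1/zeta)^(2d) modulo zeta^(2N) = 1. *)
Definition alias_cbin N d : nat :=
  \sum_(i < (2 * d).+1 | i == d %[mod N]) 'C(2 * d, i).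

(** Every i in the sum differs from d by at most d < N. *)
Lemma alias_cbin_small N d : (d < N)%N -> alias_cbin N d = cbin d.
Proof.
move=> lt_dN; have lt_d : (d < (2 * d).+1)%N by lia.
rewrite /alias_cbin (big_pred1 (Ordinal lt_d)) // => i.
apply/idP/idP => [|/eqP -> //]; have lt_i := ltn_ord i => h.
apply/eqP/val_inj => /=; move: h; case: (leqP d i) => [le_di|/ltnW le_id].
  rewrite eqn_mod_dvd // => /dvdnP [[|k]]; nia.
rewrite eq_sym eqn_mod_dvd // => /dvdnP [[|k]]; nia.
Qed.

(** Term i of the binomial expansion is the j-th power of [w i] = z^(2(d - i)), an N-th root of
    unity, so its sum over j is N or 0. The exponent being even, N values of j form a full
    period. *)
Lemma sum_cos_pow N z d : (2 * N).-primitive_root z ->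
  \sum_(1 <= j < N.+1) (z ^+ j + (z ^+ j)^-1) ^+ (2 * d) = N%:R * (alias_cbin N d)%:R :> L.
Proof.
move=> zP; have N2_gt0 := prim_order_gt0 zP; have N_gt0 : (0 < N)%N by lia.
have z0 : z != 0 by rewrite (prim_root_eq0 zP) -lt0n.
have z2P : N.-primitive_root (z ^+ 2).
  by have := dvdn_prim_root zP (dvdn_mull 2 (dvdnn N)); rewrite mulnK.
pose w i := (z ^+ 2) ^+ d / (z ^+ 2) ^+ i.
have wN i : w i ^+ N = 1.
  by rewrite expr_div_n -!(exprM _ _ N) ![(_ * N)%N]mulnC !exprM (prim_expr_order z2P) !expr1n divr1.
have w1 i : (w i == 1) = (i == d %[mod N]).
  rewrite -(eq_prim_root_expr z2P) /w eq_sym.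
  have nz : (z ^+ 2) ^+ i != 0 by rewrite !expf_neq0.
  by rewrite -(inj_eq (mulIf nz)) mul1r divfK.
transitivity (\sum_(1 <= j < N.+1) \sum_(i < (2 * d).+1) 'C(2 * d, i)%:R * w i ^+ j).
  apply: eq_bigr => j _; rewrite exprDn; apply: eq_bigr => i _.
  rewrite mulr_natl; congr (_ *+ _); have le_i := leq_ord i.
  set y := z ^+ j; have y0 k : y ^+ k != 0 by rewrite !expf_neq0.
  have -> : w i ^+ j = y ^+ (2 * d) / y ^+ (2 * i).
    by rewrite /w expr_div_n -!exprM; congr (z ^+ _ / z ^+ _); rewrite mulnC.
  by apply/eqP; rewrite exprVn eqr_div // -!exprD; apply/eqP; congr (_ ^+ _); lia.
rewrite exchange_big /= natr_sum mulr_sumr [RHS]big_mkcond; apply: eq_bigr => i _.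
by rewrite -mulr_sumr (sum_exp_root1 (wN i)) w1; case: ifP => _; rewrite ?mulr0 // mulrC.
Qed.

End RootsOfUnity.

(** * Sums over [Lambda_hat] *)

Section LambdaSum.
Variables (R : idomainType) (L : closedFieldType).
Variable (iota : {rmorphism {fraction R} -> L}).
Local Open Scope classical_set_scope.

(** Inverse roots give the same element, so exponents j and 2N - j merge; j = 0 gives the excluded
    value 2. *)
Lemma Lambda_hatE N z : (2 * N).-primitive_root z ->
  Lambda_hat iota N = [set` [seq z ^+ j + (z ^+ j)^-1 | j <- index_iota 1 N.+1]].
Proof.
move=> zP; have N2_gt0 := prim_order_gt0 zP.
have z0 : z != 0 by rewrite (prim_root_eq0 zP) -lt0n.
apply/seteqP; split=> [l [[y [_ yN] <-]] ne2 | l] /=.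
  have [[k lt_k] /= yE] := prim_rootP zP yN.
  case: (posnP k) => [k0|k_gt0].
    by case: ne2; rewrite yE k0 expr0 invr1.
  case: (leqP k N) => [le_kN|lt_Nk].
    by rewrite yE; apply/mapP; exists k => //; rewrite mem_index_iota; lia.
  apply/mapP; exists (2 * N - k)%N; first by rewrite mem_index_iota; lia.
  have -> : z ^+ (2 * N - k) = y^-1.
    rewrite yE; apply: (mulIf (expf_neq0 k z0)).
    by rewrite -exprD subnK ?(ltnW lt_k) // (prim_expr_order zP) mulVf ?expf_neq0.
  by rewrite invrK addrC.
move=> /mapP[j]; rewrite mem_index_iota => j_bnd ->; split.
  exists (z ^+ j) => //; split; last by rewrite exprAC (prim_expr_order zP) expr1n.
  exists ('X^(2 * N) - 1%:P); first exact: monicXnsubC.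
  rewrite polyC1 rmorphB rmorph1 /= map_polyXn rootE !hornerE.
  by rewrite exprAC (prim_expr_order zP) expr1n subrr.
(* The value 2 would force z^j = 1, impossible for 1 <= j <= N. *)
move=> e2; have zj0 : z ^+ j != 0 by rewrite expf_neq0.
have : (z ^+ j - 1) ^+ 2 = 0.
  have -> : (z ^+ j - 1) ^+ 2 = z ^+ j * (z ^+ j + (z ^+ j)^-1 - 2).
    by rewrite mulrBr mulrDr divff //; ring.
  by rewrite e2 subrr mulr0.
move/eqP; rewrite expf_eq0 /= subr_eq0 -(prim_order_dvd zP) => /dvdnP[[|q]]; nia.
Qed.

(** For u = z^a and v = z^b, u v ((u + 1/u) - (v + 1/v)) = (u - v) (u v - 1), and u v = 1 only for a
    = b = N. *)
Lemma uniq_cos N (z : L) : (2 * N).-primitive_root z ->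
  uniq [seq z ^+ j + (z ^+ j)^-1 | j <- index_iota 1 N.+1].
Proof.
move=> zP; have N2_gt0 := prim_order_gt0 zP.
have z0 k : z ^+ k != 0 by rewrite expf_neq0 // (prim_root_eq0 zP) -lt0n.
rewrite map_inj_in_uniq ?iota_uniq // => a b; rewrite !mem_index_iota => ha hb eab.
have : (z ^+ a - z ^+ b) * (z ^+ (a + b) - 1) = 0.
  have -> : (z ^+ a - z ^+ b) * (z ^+ (a + b) - 1) = z ^+ a * z ^+ b *
     ((z ^+ a + (z ^+ a)^-1) - (z ^+ b + (z ^+ b)^-1)).
    have Ha := divff (z0 a); have Hb := divff (z0 b); rewrite exprD.
    transitivity (z ^+ a * z ^+ b * (z ^+ a - z ^+ b)
      + z ^+ b * (z ^+ a / z ^+ a) - z ^+ a * (z ^+ b / z ^+ b)); last by ring.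
    by rewrite Ha Hb; ring.
  by rewrite eab subrr mulr0.
move/eqP; rewrite mulf_eq0 !subr_eq0 => /orP[].
  rewrite (eq_prim_root_expr zP) !modn_small; [move/eqP => // | lia | lia].
rewrite -(prim_order_dvd zP) => /dvdnP[[|[|q]]]; nia.
Qed.

(** The average of p(lambda^2) over [Lambda_hat N] when 2N is nonzero, by [Lambda_sum], but
    expressed in R without division by N. *)
Definition alias_ct N : {poly R} -> R^o := moment (fun d => (alias_cbin N d)%:R : R^o).

Lemma alias_ct_small N (p : {poly R}) : (size p <= N)%N -> alias_ct N p = ct p.
Proof.
move=> pN; rewrite /alias_ct /ct !(moment_trunc _ (leqnn (size p))).
apply: eq_bigr => d _; rewrite alias_cbin_small //; exact: leq_trans (ltn_ord d) pN.
Qed.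

Lemma Lambda_sum N (p : {poly R}) (P : {poly L}) : (2 * N)%:R != 0 :> L ->
  N%:R^-1 *: (\sum_(lambda \in Lambda_hat iota N)
     (map_poly (embed iota) (p \Po 'X^2)).[lambda] *: P) =
  embed iota (alias_ct N p) *: P.
Proof.
move=> N2; have [z zP] := closed_prim_root N2.
have N0 : N%:R != 0 :> L by apply: contraNneq N2; rewrite natrM => ->; rewrite mulr0.
rewrite (Lambda_hatE zP) -fsbig_seq ?uniq_cos // big_map -scaler_suml scalerA.
congr (_ *: _); apply: (mulfI N0); rewrite mulVKf //.
rewrite map_comp_poly map_polyXn /alias_ct /moment rmorph_sum mulr_sumr /=.
rewrite (eq_bigr (fun j => \sum_(d < size p) embed iota p`_d *
   (z ^+ j + (z ^+ j)^-1) ^+ (2 * d))).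
  rewrite exchange_big /=; apply: eq_bigr => d _.
  rewrite -mulr_sumr -[_ *: _ : R^o]/(_ * _) rmorphM rmorph_nat mulrCA; congr (_ * _).
  by rewrite -(sum_cos_pow d zP).
move=> j _; rewrite horner_comp !hornerE /map_poly horner_poly.
by apply: eq_bigr => d _; rewrite -exprM.
Qed.

End LambdaSum.

(** * Assembly of the remainder *)

Theorem theorem5p14 (R : idomainType) (kappa : R)
    (Fbar : closedFieldType) (iota : {rmorphism {fraction R} -> Fbar})
    (Fbar_closure : is_algebraic_closure iota)
    (R_pchar_neq2 : 2%N \notin [pchar R])
    (f : {poly R}) (m : nat)
    (f_dvd : exists g : {poly R}, f \Po 'X^2 = g * ('X^2 - 4) ^+ m)
    (n N : nat) (n_gt0 : (0 < n)%N) (n_le_N : (n <= N)%N)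
    (pchar_ndvd : forall p : nat, p \in [pchar R] -> ~~ (p %| N)%N) :
  exists r : {poly R},
    (size (r \Po 'X^2) <= maxn (size (f \Po 'X^2)) (2 * n - 2 * m - 1))%N /\
    map_poly (embed iota) (Phi kappa ('X_vx ^+ (2 * n) * at_y2 f)) =
      N%:R^-1 *:
        (\sum_(i < m.+1) 'C(2 * i, i)%:R *:
           \sum_(lambda \in Lambda_hat iota N)
              (map_poly (embed iota) (quot_poly kappa f i)).[lambda] *:
                (map_poly intr (bpoly (n%:Z - i%:Z)) \Po 'X^2))
      + map_poly (embed iota) (r \Po 'X^2).
Proof.
have two0 : (2 : R) != 0 by move: R_pchar_neq2; rewrite inE /=.
have N_gt0 : (0 < N)%N by apply: leq_trans n_le_N.
have NR0 : N%:R != 0 :> R.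
  apply/negP => N0; have [p p_char] := natf0_pchar N_gt0 N0.
  by have := pchar_ndvd p p_char; rewrite (dvdn_pcharf p_char) N0.
have N2 : (2 * N)%:R != 0 :> Fbar.
  rewrite -(rmorph_nat (embed iota)) fmorph_eq0 tofrac_eq0 natrM mulf_eq0 negb_or.
  by rewrite two0.
have [g fE] : exists h, f = ('X - 4) ^+ m * h.
  have [h hE] := f_dvd; rewrite -[4]polyC_natr; apply: (@dvd_comp_X2 _ _ h).
  by rewrite hE polyC_natr.
have [G GP] := choice (Phi_mon_asymp kappa two0 n).
pose q i := ('X - kappa%:P) ^+ i * ('X - 4) ^+ (m - i) * g.
pose b i : {poly R} := map_poly intr (bpoly (n%:Z - i%:Z)).
(* The double sum of the theorem, pulled back to R and written in t = x^2; the division by N is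
   absorbed in [alias_ct]. *)
pose H := \sum_(i < m.+1) (cbin i)%:R *: (alias_ct N (q i) *: b i).
pose r := \sum_(d < size f) f`_d *: G d - H.
exists r; split; last first.
  rewrite Phi_at_y2.
  have -> : \sum_(d < size f) f`_d *: Phi_mon kappa (2 * n) (2 * d) 0 =
      (\sum_(d < size f) f`_d *: G d) \Po 'X^2.
    rewrite linear_sum; apply: eq_bigr => d _ /=.
    by rewrite comp_polyZ (GP d).1.
  rewrite -[X in X \Po _](subrKC H) -/r comp_polyD rmorphD /=; congr (_ + _).
  rewrite /H linear_sum rmorph_sum scaler_sumr; apply: eq_bigr => i _ /=.
  rewrite !comp_polyZ !map_polyZ rmorph_nat [RHS]scalerA [_^-1 * _]mulrC -[RHS]scalerA; congr (_ *: _).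
  rewrite (quot_poly_comp_X2 _ fE (leq_ord i)) -/(q i) (Lambda_sum iota _ _ N2).
  congr (_ *: _).
  rewrite map_comp_poly map_polyXn -map_poly_comp /=; congr (_ \Po _).
  by apply: eq_map_poly => c /=; rewrite rmorph_int.
have bE i : (i <= n)%N -> b i = btrunc R (n - i).
  by move=> le_in; rewrite /b /btrunc subzn.
have szb i : (size (b i) <= n.+1)%N.
  case: (leqP i n) => [le_in|lt_ni].
    by rewrite bE // (leq_trans (size_btrunc _ _)) // ltnS leq_subr.
  rewrite /b; case E: (n%:Z - i%:Z) => [k|k]; first by lia.
  by rewrite /= rmorph0 size_poly0.
have szr : (size r <= maxn (size f) (n - m))%N.
  have monX4 : ('X - 4 : {poly R}) \is monic by rewrite -[4]polyC_natr monicXsubC.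
  have sX4 k : size (('X - 4 : {poly R}) ^+ k) = k.+1.
    by rewrite -[4]polyC_natr size_exp_XsubC.
  have [f0|f0] := eqVneq f 0.
    have g0 : g = 0.
      by apply/eqP; move/eqP: fE; rewrite f0 eq_sym mulf_eq0 expf_eq0 (negPf (monic_neq0 monX4)) andbF.
    rewrite /r f0 [X in X - _]big1 => [|d _]; last by rewrite coef0 scale0r.
    rewrite /H big1 ?subr0 ?size_poly0 // => i _.
    by rewrite /q g0 mulr0 /alias_ct linear0 scale0r scaler0.
  (* If deg f < n <= N, averages are true constant terms and [approx_core] applies; otherwise each
     sum alone has size at most that of f. *)
  case: (leqP (size f) n) => [le_fn|lt_nf].
    have -> : r = \sum_(d < size f) f`_d *: G d - \sum_(i < m.+1) (cbin i)%:R *: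
         (ct (q i) *: btrunc R (n - i)).
      congr (_ - _); apply: eq_bigr => i _.
      have le_im := leq_ord i.
      have g0 : g != 0 by apply: contraNneq f0 => g0; rewrite fE g0 mulr0.
      have szf : size f = (m + size g)%N.
        by rewrite fE size_monicM ?monic_exp // sX4 addSn.
      (* Trading factors X - 4 for X - kappa keeps the degree, so [q i] has degree below N too. *)
      have szq : size (q i) = size f.
        rewrite /q -mulrA size_monicM ?monic_exp ?monicXsubC //; last first.
          by rewrite mulf_neq0 // expf_neq0 // monic_neq0.
        rewrite size_exp_XsubC size_monicM ?monic_exp // sX4 szf !addSn /=.
        by rewrite addnA subnKC.
      rewrite bE ?alias_ct_small ?szq //; first exact: leq_trans le_fn n_le_N.
      apply: leq_trans le_im (leq_trans _ le_fn); rewrite szf; exact: leq_addr.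
    by apply: approx_core => // d; case: (GP d).
  apply: leq_trans (leq_maxl _ _); apply: size_polyB_le; apply: size_poly_sum_le => i _.
    apply: leq_trans (size_scale_leq _ _) _; have [_ /approx_size] := GP i.
    by move/leq_trans; apply; rewrite gtn_max ltn_ord.
  apply: leq_trans (size_scale_leq _ _) (leq_trans (size_scale_leq _ _) _).
  exact: leq_trans (szb i) lt_nf.
rewrite !size_comp_X2; move: szr; move: (size r) (size f) => a c; lia.
Qed.
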